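(* Let $k$ be a field, $R=k[c]$ the polynomial ring in one variable, and $A=kQ/I$ where $(Q,I)$ is a gentle quiver. Let $B=kQ'$ be the path algebra of the quiver $Q'$ obtained from $(Q,I)$ by splitting vertices (see context). The following conditions are equivalent: (1) $A$ admits the structure of a finite projective $R$-algebra; (2) $B$ admits the structure of a finite projective $R$-algebra; (3) each arrow of $Q'$ lies on a cyclic path; (4) each arrow of $Q$ lies on an admissible cycle.
   Context: A finite projective $R$-algebra is an associative $R$-algebra that is finitely generated and projective as an $R$-module. Paths are composed from right to left. Gentle quiver $(Q,I)$: $Q=(Q_0,Q_1,s,t)$ is a finite quiver and $I$ is an ideal of $kQ$ generated by paths of length two such that: (Ge1) at most two arrows start at each vertex; (Ge2) at most two arrows end at each vertex; (Ge3) for each $\alpha\in Q_1$ there is at most one arrow $\beta$ with $s(\beta)=t(\alpha)$ and $\beta\alpha\in I$, and at most one arrow $\beta'$ with $s(\beta')=t(\alpha)$ and $\beta'\alpha\notin I$; (Ge4) for each $\beta\in Q_1$ there is at most one arrow $\alpha$ with $t(\alpha)=s(\beta)$ and $\beta\alpha\in I$, and at most one arrow $\alpha'$ with $t(\alpha')=s(\beta)$ and $\beta\alpha'\notin I$. The algebra $A=kQ/I$ need not be finite dimensional. Admissible cycle: for $\alpha\in Q_1$ let $p_\alpha=\alpha_n\cdots\alpha_1$ be the unique maximal repetition-free path with $\alpha_1=\alpha$ and $p_\alpha\notin I$, i.e. the arrows $\alpha_1,\dots,\alpha_n$ are distinct, $p_\alpha\notin I$, and every arrow $\beta$ with $s(\beta)=t(\alpha_n)$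 satisfies $\beta=\alpha_1$ or $\beta\alpha_n\in I$. It is called an admissible cycle if it is a cyclic path with $\alpha_1\alpha_n\notin I$. The quiver $Q'=(Q_0',Q_1',s',t')$: let $Q_0^*$ be the set of all vertices $i\in Q_0$ such that no arrow of $Q$ starts or ends in $i$. Set $Q_0'=Q_0^*\cup\{s_\alpha,t_\alpha\mid\alpha\in Q_1\}/{\sim}$, where $\sim$ is the smallest equivalence relation such that $s_\beta\sim t_\alpha$ for all $\alpha,\beta\in Q_1$ with $s(\beta)=t(\alpha)$ and $\beta\alpha\notin I$. Set $Q_1'=Q_1$, $s'(\alpha)=[s_\alpha]$ and $t'(\alpha)=[t_\alpha]$ for $\alpha\in Q_1'$.
   Formalization: The full equivalence is stated for Q with no isolated vertex, since for one vertex and no arrows (3) and (4) hold but A = B = k is not projective over k[c]; for every gentle (Q,I) it still states (1)⇔(2), (3)⇔(4) and (1)⇒(3). *)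

(* Defs.v *)
From HB Require Import structures.
From mathcomp Require Import all_boot all_algebra finmap boolp.
From mathcomp Require Import monalg.

Set Implicit Arguments.
Unset Strict Implicit.
Unset Printing Implicit Defensive.

Import GRing.Theory.
Local Open Scope ring_scope.
Local Open Scope quotient_scope.

(* An R-algebra structure on a ring A is a ring morphism from R to the centre *)
(* of A; the induced R-module is A with r *: x := str r * x.  The library's   *)
(* algType is not used because it excludes the zero ring, which is the path   *)
(* algebra of the empty quiver.                                               *)

Record algebra_structure (R : comPzRingType) (A : pzRingType) :=
  AlgebraStructure {
    str :> {rmorphism R -> A};
    str_central : forall r x, str r * x = x * str r
  }.

Definition alg_module (R : comPzRingType) (A : pzRingType)
  (phi : algebra_structure R A) : Type := A.

Section AlgModule.
Variables (R : comPzRingType) (A : pzRingType) (phi : algebra_structure R A).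

HB.instance Definition _ := GRing.Zmodule.copy (alg_module phi) A.

Definition alg_scale (r : R) (x : alg_module phi) : alg_module phi :=
  phi r * (x : A).

Fact alg_scaleA r s x : alg_scale r (alg_scale s x) = alg_scale (r * s) x.
Proof. by rewrite /alg_scale rmorphM mulrA. Qed.
Fact alg_scale1 : left_id 1 alg_scale.
Proof. by move=> x; rewrite /alg_scale rmorph1 mul1r. Qed.
Fact alg_scaleDr : right_distributive alg_scale +%R.
Proof. by move=> r x y; apply: mulrDr. Qed.
Fact alg_scaleDl x : {morph alg_scale^~ x : r s / r + s}.
Proof. by move=> r s; rewrite /alg_scale rmorphD; apply: mulrDl. Qed.

HB.instance Definition _ := GRing.Zmodule_isLmodule.Build R (alg_module phi)
  alg_scaleA alg_scale1 alg_scaleDr alg_scaleDl.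
End AlgModule.

Definition finitely_generated (R : pzRingType) (M : lmodType R) : Prop :=
  exists (n : nat) (v : 'I_n -> M),
    forall x : M, exists c : 'I_n -> R, x = \sum_(i < n) c i *: v i.

Definition projective (R : pzRingType) (P : lmodType R) : Prop :=
  forall (M N : lmodType R) (f : {linear M -> N}) (g : {linear P -> N}),
    (forall y : N, exists x : M, f x = y) ->
    exists h : {linear P -> M}, forall x : P, f (h x) = g x.

Definition finite_projective_algebra (R : comPzRingType) (A : pzRingType)
  (phi : algebra_structure R A) : Prop :=
  finitely_generated (alg_module phi) /\ projective (alg_module phi).

(* The k[c]-algebra structure is required to extend the given k-algebra       *)
(* structure of A.                                                            *)
Definition admits_finite_projective_polyalgebra (k : fieldType)
  (A : pzRingType) (iota : algebra_structure k A) : Prop :=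
  exists phi : algebra_structure {poly k} A,
    (forall a : k, phi a%:P = iota a) /\ finite_projective_algebra phi.

Record ideal (A : pzRingType) := Ideal {
  in_ideal :> A -> Prop;
  ideal0 : in_ideal 0;
  idealD : forall x y, in_ideal x -> in_ideal y -> in_ideal (x + y);
  idealMl : forall a x, in_ideal x -> in_ideal (a * x);
  idealMr : forall a x, in_ideal x -> in_ideal (x * a)
}.

Definition ideal_generated_by (A : pzRingType) (S : A -> Prop) (I : ideal A) :=
  forall x, I x <-> (forall J : ideal A, (forall y, S y -> J y) -> J x).

Section QuotientRing.
Variables (A : pzRingType) (I : ideal A).

Lemma idealN x : I x -> I (- x).
Proof. by move=> Ix; rewrite -mulN1r; apply: idealMl. Qed.

Definition ideal_equiv : rel A := fun x y => `[< I (x - y) >].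

Fact ideal_equiv_refl : reflexive ideal_equiv.
Proof. by move=> x; apply/asboolP; rewrite subrr; apply: ideal0. Qed.
Fact ideal_equiv_sym : symmetric ideal_equiv.
Proof.
by move=> x y; apply/asboolP/asboolP => /idealN; rewrite opprB.
Qed.
Fact ideal_equiv_trans : transitive ideal_equiv.
Proof.
move=> y x z /asboolP xy /asboolP yz; apply/asboolP.
by rewrite -[x](subrK y) -addrA; apply: idealD.
Qed.

Canonical ideal_equivRel :=
  EquivRel ideal_equiv ideal_equiv_refl ideal_equiv_sym ideal_equiv_trans.

Definition quotient_ring : Type := {eq_quot ideal_equivRel}.
HB.instance Definition _ := Choice.on quotient_ring.
HB.instance Definition _ := EqQuotient.on quotient_ring.

Local Notation pi := (\pi_quotient_ring).

Lemma quotient_eqP x y : reflect (I (x - y)) (pi x == pi y).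
Proof. by rewrite piE; apply: (iffP (asboolP _)). Qed.

Lemma quotient_reprB x : I (repr (pi x) - x).
Proof. by apply/quotient_eqP; rewrite reprK. Qed.

Definition quo_opp := lift_op1 quotient_ring -%R.
Definition quo_add := lift_op2 quotient_ring +%R.
Definition quo_mul := lift_op2 quotient_ring *%R.

Lemma quo_oppE x : quo_opp (pi x) = pi (- x).
Proof.
unlock quo_opp; apply/eqP/quotient_eqP; rewrite -opprD; apply: idealN; exact: quotient_reprB.
Qed.
Lemma quo_addE x y : quo_add (pi x) (pi y) = pi (x + y).
Proof.
unlock quo_add; apply/eqP/quotient_eqP; rewrite opprD addrACA.
by apply: idealD; apply: quotient_reprB.
Qed.
Lemma quo_mulE x y : quo_mul (pi x) (pi y) = pi (x * y).
Proof.
unlock quo_mul; apply/eqP/quotient_eqP.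
have -> : repr (pi x) * repr (pi y) - x * y =
    repr (pi x) * (repr (pi y) - y) + (repr (pi x) - x) * y.
  by rewrite mulrBr mulrBl addrA subrK.
apply: idealD; [apply: idealMl|apply: idealMr]; exact: quotient_reprB.
Qed.

Fact quo_addA : associative quo_add.
Proof.
by elim/quotW=> x; elim/quotW=> y; elim/quotW=> z; rewrite !quo_addE addrA.
Qed.
Fact quo_addC : commutative quo_add.
Proof. by elim/quotW=> x; elim/quotW=> y; rewrite !quo_addE addrC. Qed.
Fact quo_add0 : left_id (pi 0) quo_add.
Proof. by elim/quotW=> x; rewrite quo_addE add0r. Qed.
Fact quo_addN : left_inverse (pi 0) quo_opp quo_add.
Proof. by elim/quotW=> x; rewrite quo_oppE quo_addE addNr. Qed.
Fact quo_mulA : associative quo_mul.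
Proof.
by elim/quotW=> x; elim/quotW=> y; elim/quotW=> z; rewrite !quo_mulE mulrA.
Qed.
Fact quo_mul1r : left_id (pi 1) quo_mul.
Proof. by elim/quotW=> x; rewrite quo_mulE mul1r. Qed.
Fact quo_mulr1 : right_id (pi 1) quo_mul.
Proof. by elim/quotW=> x; rewrite quo_mulE mulr1. Qed.
Fact quo_mulDl : left_distributive quo_mul quo_add.
Proof.
elim/quotW=> x; elim/quotW=> y; elim/quotW=> z.
by rewrite !(quo_addE, quo_mulE) mulrDl.
Qed.
Fact quo_mulDr : right_distributive quo_mul quo_add.
Proof.
elim/quotW=> x; elim/quotW=> y; elim/quotW=> z.
by rewrite !(quo_addE, quo_mulE) mulrDr.
Qed.

HB.instance Definition _ := GRing.isZmodule.Build quotient_ring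
  quo_addA quo_addC quo_add0 quo_addN.
HB.instance Definition _ := GRing.Zmodule_isPzRing.Build quotient_ring
  quo_mulA quo_mul1r quo_mulr1 quo_mulDl quo_mulDr.

Definition quotient_map (x : A) : quotient_ring := pi x.

Fact quotient_map_zmod : zmod_morphism quotient_map.
Proof.
by move=> x y; rewrite /quotient_map -quo_addE -quo_oppE.
Qed.
Fact quotient_map_monoid : monoid_morphism quotient_map.
Proof. by split=> // x y; rewrite /quotient_map -quo_mulE. Qed.

HB.instance Definition _ :=
  GRing.isZmodMorphism.Build A quotient_ring quotient_map quotient_map_zmod.
HB.instance Definition _ :=
  GRing.isMonoidMorphism.Build A quotient_ring quotient_map quotient_map_monoid.

Variables (R : comPzRingType) (iota : algebra_structure R A).

Fact quotient_str_central r x :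
  (quotient_map \o iota) r * x = x * (quotient_map \o iota) r.
Proof.
elim/quotW: x => x.
have := congr1 quotient_map (str_central iota r x).
by rewrite !(rmorphM quotient_map).
Qed.

Definition quotient_algebra : algebra_structure R quotient_ring :=
  @AlgebraStructure R quotient_ring (quotient_map \o iota) quotient_str_central.
End QuotientRing.

Record quiver := Quiver {
  Q0 : finType;
  Q1 : finType;
  src : Q1 -> Q0;
  tgt : Q1 -> Q0
}.

(* The path a_n ... a_1 (composed from right to left) is stored as its source *)
(* together with the sequence [:: a_1; ...; a_n] in the order of traversal;   *)
(* the trivial path at i is (i, [::]).                                        *)
Section Paths.
Variable Q : quiver.

Fixpoint chain (i : Q0 Q) (s : seq (Q1 Q)) : bool :=
  if s is a :: s' then (src a == i) && chain (tgt a) s' else true.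

Record qpath := QPath {
  qpath_val : Q0 Q * seq (Q1 Q);
  _ : chain qpath_val.1 qpath_val.2
}.

HB.instance Definition _ := [isSub for qpath_val].
HB.instance Definition _ := [Countable of qpath by <:].

Definition psrc (p : qpath) : Q0 Q := (qpath_val p).1.
Definition arrows (p : qpath) : seq (Q1 Q) := (qpath_val p).2.
Definition chain_tgt (i : Q0 Q) (s : seq (Q1 Q)) : Q0 Q :=
  last i (map (@tgt Q) s).
Definition ptgt (p : qpath) : Q0 Q := chain_tgt (psrc p) (arrows p).

Definition trivial_path (i : Q0 Q) : qpath := @QPath (i, [::]) isT.

Fact arrow_path_subproof (a : Q1 Q) : chain (src a) [:: a].
Proof. by rewrite /= eqxx. Qed.
Definition arrow_path (a : Q1 Q) : qpath :=
  @QPath (src a, [:: a]) (arrow_path_subproof a).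

(* The composite q p (first p, then q), or None if p and q do not compose.    *)
Definition pcomp (q p : qpath) : option qpath :=
  if psrc q == ptgt p then insub (psrc p, arrows p ++ arrows q) else None.

Definition cyclic_path (p : qpath) : Prop :=
  (0 < size (arrows p))%N /\ psrc p = ptgt p.

Lemma chain_cat i s1 s2 :
  chain i (s1 ++ s2) = chain i s1 && chain (chain_tgt i s1) s2.
Proof. by elim: s1 i => //= a s IH i; rewrite IH andbA. Qed.

Lemma pcompP q p : psrc q = ptgt p ->
  exists2 r, pcomp q p = Some r &
    qpath_val r = (psrc p, arrows p ++ arrows q).
Proof.
move=> qp; rewrite /pcomp qp eqxx; case: insubP => [r _ rE|]; first by exists r.
case: q p qp => [[i s] /= hs] [[j t] /= ht]; rewrite /psrc /ptgt /= => ij.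
by rewrite chain_cat ht /= -[chain_tgt j t]ij hs.
Qed.

Lemma pcomp_none q p : psrc q != ptgt p -> pcomp q p = None.
Proof. by rewrite /pcomp => /negbTE->. Qed.

Lemma pcompA p3 p2 p1 :
  obind (pcomp p3) (pcomp p2 p1) = obind (pcomp^~ p1) (pcomp p3 p2).
Proof.
have [h21|h21] := eqVneq (psrc p2) (ptgt p1); last first.
  rewrite (pcomp_none h21) /=.
  have [/pcompP[r -> rE]|/pcomp_none->//] := eqVneq (psrc p3) (ptgt p2).
  by rewrite /= pcomp_none // /psrc rE.
have [r r21 rE] := pcompP h21; rewrite r21 /=.
have rt : ptgt r = ptgt p2.
  by rewrite /ptgt /psrc /arrows rE /= /chain_tgt map_cat last_cat -[RHS]/(
    last (psrc p2) _) h21.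
have [h32|h32] := eqVneq (psrc p3) (ptgt p2); last first.
  by rewrite (pcomp_none h32) pcomp_none // rt.
have [q q32 qE] := pcompP h32; rewrite q32 /=.
have h3r : psrc p3 = ptgt r by rewrite rt.
have hq1 : psrc q = ptgt p1 by rewrite /psrc qE.
have [u -> uE] := pcompP h3r; have [v -> vE] := pcompP hq1.
congr Some; apply: val_inj; rewrite /= uE vE /psrc /arrows rE qE /=.
by rewrite catA.
Qed.

Lemma pcomp_triv_l p i :
  pcomp (trivial_path i) p = if i == ptgt p then Some p else None.
Proof.
have [h|h] := eqVneq i (ptgt p); last exact: pcomp_none.
have [r -> rE] := @pcompP (trivial_path i) p h.
congr Some; apply: val_inj; rewrite /= rE /arrows /= cats0.
by case: p {h rE} => [[]].
Qed.

Lemma pcomp_triv_r p i :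
  pcomp p (trivial_path i) = if psrc p == i then Some p else None.
Proof.
have [h|h] := eqVneq (psrc p) i; last exact: pcomp_none.
have [r -> rE] := @pcompP p (trivial_path i) h.
congr Some; apply: val_inj; rewrite /= rE /psrc /= -h.
by case: p {h rE} => [[]].
Qed.
End Paths.

(* k-linear combinations of paths, with the k-bilinear extension of path      *)
(* composition as product.                                                    *)
Definition path_algebra (k : fieldType) (Q : quiver) : Type :=
  {malg k[qpath Q]}.

Definition opath (k : fieldType) (Q : quiver) (c : k) (o : option (qpath Q)) :
    {malg k[qpath Q]} :=
  oapp (fun p => << c *g p >>) 0 o.

HB.lock Definition pa_mul (k : fieldType) (Q : quiver)
    (x y : {malg k[qpath Q]}) : {malg k[qpath Q]} :=
  \sum_(q <- msupp x) \sum_(p <- msupp y) opath (x@_q * y@_p) (pcomp q p).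
Arguments pa_mul {k Q}.

Section PathAlgebra.
Variables (k : fieldType) (Q : quiver).
Local Notation kQ := (path_algebra k Q).
Local Notation mal := {malg k[qpath Q]}.
Local Open Scope fset_scope.
Local Open Scope ring_scope.

HB.instance Definition _ := GRing.Lmodule.copy (path_algebra k Q) {malg k[qpath Q]}.

Definition pa_one : mal := \sum_(i : Q0 Q) << trivial_path i >>.

Lemma opath0 o : @opath k Q 0 o = 0.
Proof. by case: o => //= p; rewrite monalgU0. Qed.
Lemma opathD c d o : @opath k Q (c + d) o = opath c o + opath d o.
Proof. by case: o => [p|] /=; rewrite ?monalgUD ?addr0. Qed.

Lemma opathZ c d o : @opath k Q (c * d) o = c *: opath d o.
Proof.
case: o => [p|]; last by rewrite scaler0.
apply/malgP=> u; rewrite mcoeffZ.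
exact: (etrans (mcoeffU _ _ _) (etrans (esym (mulrnAr _ _ _))
  (congr1 _ (esym (mcoeffU _ _ _))))).
Qed.

Lemma pa_mulw (d1 d2 : {fset qpath Q}) (x y : mal) :
  msupp x `<=` d1 -> msupp y `<=` d2 ->
  pa_mul x y = \sum_(q <- d1) \sum_(p <- d2) opath (x@_q * y@_p) (pcomp q p).
Proof.
move=> le1 le2; rewrite pa_mul.unlock (big_fset_incl _ le1) /=.
  apply/eq_bigr=> q _; apply/big_fset_incl => // p _ /mcoeff_outdom ->.
  by rewrite mulr0 opath0.
move=> q _ /mcoeff_outdom xq.
by rewrite big1 // => p _; rewrite xq mul0r opath0.
Qed.

Lemma pa_mul0l : left_zero (0 : mal) pa_mul.
Proof. by move=> x; rewrite pa_mul.unlock msupp0 big_seq_fset0. Qed.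
Lemma pa_mul0r : right_zero (0 : mal) pa_mul.
Proof.
by move=> x; rewrite pa_mul.unlock big1 // => q _; rewrite msupp0 big_seq_fset0.
Qed.

Lemma pa_mulUU c d q p :
  pa_mul << c *g q >> << d *g p >> = @opath k Q (c * d) (pcomp q p).
Proof. by rewrite (pa_mulw msuppU_le msuppU_le) !big_seq_fset1 !mcoeffUU. Qed.

Fact pa_mulDl : left_distributive (@pa_mul k Q) +%R.
Proof.
move=> x y z.
rewrite (pa_mulw (msuppD_le x y) (fsubset_refl (msupp z))).
rewrite (pa_mulw (fsubsetUl (msupp x) (msupp y)) (fsubset_refl (msupp z))).
rewrite (pa_mulw (fsubsetUr (msupp x) (msupp y)) (fsubset_refl (msupp z))).
rewrite -big_split /=; apply/eq_bigr=> q _.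
rewrite -big_split /=; apply/eq_bigr=> p _.
by rewrite mcoeffD mulrDl opathD.
Qed.

Fact pa_mulDr : right_distributive (@pa_mul k Q) +%R.
Proof.
move=> z x y.
rewrite (pa_mulw (fsubset_refl (msupp z)) (msuppD_le x y)).
rewrite (pa_mulw (fsubset_refl (msupp z)) (fsubsetUl (msupp x) (msupp y))).
rewrite (pa_mulw (fsubset_refl (msupp z)) (fsubsetUr (msupp x) (msupp y))).
rewrite -big_split /=; apply/eq_bigr=> q _.
rewrite -big_split /=; apply/eq_bigr=> p _.
by rewrite mcoeffD mulrDr opathD.
Qed.

Lemma pa_mul_suml (T : Type) (r : seq T) (F : T -> mal) y :
  pa_mul (\sum_(i <- r) F i) y = \sum_(i <- r) pa_mul (F i) y.
Proof.
exact: (big_morph (pa_mul^~ y) (fun _ _ => pa_mulDl _ _ _) (pa_mul0l _)).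
Qed.
Lemma pa_mul_sumr (T : Type) (r : seq T) (F : T -> mal) x :
  pa_mul x (\sum_(i <- r) F i) = \sum_(i <- r) pa_mul x (F i).
Proof.
exact: (big_morph (pa_mul x) (fun _ _ => pa_mulDr _ _ _) (pa_mul0r _)).
Qed.

Lemma pa_ind (P : mal -> Prop) :
  P 0 -> (forall x y, P x -> P y -> P (x + y)) ->
  (forall c p, P << c *g p >>) -> forall x, P x.
Proof. by move=> P0 PD PU x; rewrite [x]monalgE; apply: big_ind. Qed.

Lemma pa_mulUo c (q : qpath Q) d o :
  pa_mul << c *g q >> (opath d o) = @opath k Q (c * d) (obind (pcomp q) o).
Proof. case: o => [p|]; [exact: pa_mulUU | exact: pa_mul0r]. Qed.
Lemma pa_muloU c o d (p : qpath Q) :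
  pa_mul (opath c o) << d *g p >> = @opath k Q (c * d) (obind (@pcomp Q ^~ p) o).
Proof. case: o => [q|]; [exact: pa_mulUU | exact: pa_mul0l]. Qed.

Fact pa_mulA : associative (@pa_mul k Q).
Proof.
pose assoc (x y z : mal) := pa_mul x (pa_mul y z) = pa_mul (pa_mul x y) z.
have Az x y : (forall c p, assoc x y << c *g p >>) -> forall z, assoc x y z.
  rewrite /assoc => H; elim/pa_ind => [|z z' IH IH'|//].
    by rewrite !pa_mul0r.
  by rewrite !pa_mulDr IH IH'.
have Ay x z : (forall c p, assoc x << c *g p >> z) -> forall y, assoc x y z.
  rewrite /assoc => H; elim/pa_ind => [|y y' IH IH'|//].
    by rewrite pa_mul0r pa_mul0l pa_mul0r.
  by rewrite pa_mulDr !pa_mulDl pa_mulDr IH IH'.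
have Ax y z : (forall c p, assoc << c *g p >> y z) -> forall x, assoc x y z.
  rewrite /assoc => H; elim/pa_ind => [|x x' IH IH'|//].
    by rewrite !pa_mul0l.
  by rewrite !pa_mulDl IH IH'.
move=> x y z; apply: (Ax) => c3 q3; apply: (Ay) => c2 q2; apply: (Az) => c1 q1.
apply: etrans (congr1 (pa_mul _) (pa_mulUU c2 c1 q2 q1)) _.
apply: etrans _ (congr1 (pa_mul^~ _) (esym (pa_mulUU c3 c2 q3 q2))).
by rewrite pa_mulUo pa_muloU pcompA mulrA.
Qed.

Fact pa_mul1l : left_id pa_one pa_mul.
Proof.
move=> x; rewrite [x in pa_mul _ x]monalgE pa_mul_sumr [RHS]monalgE.
apply/eq_bigr=> p _; rewrite pa_mul_suml (bigD1 (ptgt p)) //= big1 ?addr0.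
  by rewrite pa_mulUU pcomp_triv_l eqxx mul1r.
by move=> i /negbTE ip; rewrite pa_mulUU pcomp_triv_l ip.
Qed.

Fact pa_mul1r : right_id pa_one pa_mul.
Proof.
move=> x; rewrite [x in pa_mul x]monalgE pa_mul_suml [RHS]monalgE.
apply/eq_bigr=> p _; rewrite pa_mul_sumr (bigD1 (psrc p)) //= big1 ?addr0.
  by rewrite pa_mulUU pcomp_triv_r eqxx mulr1.
by move=> i /negbTE ip; rewrite pa_mulUU pcomp_triv_r eq_sym ip.
Qed.

HB.instance Definition _ := GRing.Zmodule_isPzRing.Build (path_algebra k Q)
  pa_mulA pa_mul1l pa_mul1r pa_mulDl pa_mulDr.

Lemma pa_scalel c (x y : mal) : pa_mul (c *: x) y = c *: pa_mul x y.
Proof.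
rewrite (pa_mulw (msuppZ_le c x) (fsubset_refl (msupp y))) pa_mul.unlock.
rewrite scaler_sumr; apply/eq_bigr=> q _.
rewrite scaler_sumr; apply/eq_bigr=> p _.
by rewrite mcoeffZ -mulrA (opathZ c).
Qed.

Lemma pa_scaler c (x y : mal) : pa_mul x (c *: y) = c *: pa_mul x y.
Proof.
rewrite (pa_mulw (fsubset_refl (msupp x)) (msuppZ_le c y)) pa_mul.unlock.
rewrite scaler_sumr; apply/eq_bigr=> q _.
rewrite scaler_sumr; apply/eq_bigr=> p _.
by rewrite mcoeffZ mulrCA (opathZ c).
Qed.

Definition pa_scalar (c : k) : kQ := c *: (1 : kQ).

Fact pa_scalar_zmod : zmod_morphism pa_scalar.
Proof. by move=> c d; apply: scalerBl. Qed.
Fact pa_scalar_monoid : monoid_morphism pa_scalar.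
Proof.
split=> [|c d]; first exact: scale1r.
rewrite /pa_scalar -[RHS]/(pa_mul (c *: pa_one) (d *: pa_one)).
by rewrite pa_scalel pa_scaler pa_mul1l scalerA.
Qed.
HB.instance Definition _ :=
  GRing.isZmodMorphism.Build k kQ pa_scalar pa_scalar_zmod.
HB.instance Definition _ :=
  GRing.isMonoidMorphism.Build k kQ pa_scalar pa_scalar_monoid.

Fact pa_scalar_central c (x : kQ) : pa_scalar c * x = x * pa_scalar c.
Proof.
rewrite -[LHS]/(pa_mul (c *: pa_one) x) -[RHS]/(pa_mul x (c *: pa_one)).
by rewrite pa_scalel pa_scaler pa_mul1l pa_mul1r.
Qed.

Definition path_algebra_str : algebra_structure k kQ :=
  @AlgebraStructure k kQ pa_scalar pa_scalar_central.

Definition path_elt (p : qpath Q) : kQ := << p >>.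
Definition arrow_elt (a : Q1 Q) : kQ := path_elt (arrow_path a).

Lemma path_eltM q p :
  path_elt q * path_elt p = oapp path_elt 0 (pcomp q p).
Proof.
by rewrite -[LHS]/(pa_mul << q >> << p >>) pa_mulUU mulr1; case: pcomp.
Qed.
End PathAlgebra.

Section Gentle.
Variables (k : fieldType) (Q : quiver) (I : ideal (path_algebra k Q)).

Local Notation "b ⋅ a" := (arrow_elt k b * arrow_elt k a)
  (at level 40, no associativity).

Definition generated_by_length_two_paths : Prop :=
  exists S : qpath Q -> Prop,
    (forall p, S p -> size (arrows p) = 2%N) /\
    ideal_generated_by (fun x => exists2 p, S p & x = path_elt k p) I.

Definition Ge1 : Prop :=
  forall i : Q0 Q, (#|[set a : Q1 Q | src a == i]| <= 2)%N.
Definition Ge2 : Prop :=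
  forall i : Q0 Q, (#|[set a : Q1 Q | tgt a == i]| <= 2)%N.
Definition Ge3 : Prop :=
  forall a b b' : Q1 Q, src b = tgt a -> src b' = tgt a ->
    (I (b ⋅ a) -> I (b' ⋅ a) -> b = b') /\
    (~ I (b ⋅ a) -> ~ I (b' ⋅ a) -> b = b').
Definition Ge4 : Prop :=
  forall b a a' : Q1 Q, tgt a = src b -> tgt a' = src b ->
    (I (b ⋅ a) -> I (b ⋅ a') -> a = a') /\
    (~ I (b ⋅ a) -> ~ I (b ⋅ a') -> a = a').

Definition gentle : Prop :=
  [/\ generated_by_length_two_paths, Ge1, Ge2, Ge3 & Ge4].

(* p is the path p_a = a_n ... a_1 with a_1 = a; here a_n = last a s.         *)
Definition maximal_path_from (a : Q1 Q) (p : qpath Q) : Prop :=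
  exists2 s, arrows p = a :: s &
    [/\ uniq (arrows p), ~ I (path_elt k p) &
        forall b, src b = tgt (last a s) -> b = a \/ I (b ⋅ last a s)].

Definition admissible_cycle (p : qpath Q) : Prop :=
  exists a, [/\ maximal_path_from a p, cyclic_path p &
                ~ I (a ⋅ last a (arrows p))].

Definition isolated (i : Q0 Q) : bool :=
  [forall a : Q1 Q, (src a != i) && (tgt a != i)].

(* inl i is the vertex i of Q_0^*, inr (inl a) is s_a, inr (inr a) is t_a.    *)
Definition pre_vertex : finType :=
  ({i : Q0 Q | isolated i} + (Q1 Q + Q1 Q))%type.

Definition glue : rel pre_vertex := fun x y =>
  match x, y with
  | inr (inl b), inr (inr a) => `[< src b = tgt a /\ ~ I (b ⋅ a) >]
  | _, _ => false
  end.

(* The reflexive transitive closure of the symmetrised relation, that is, the *)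
(* smallest equivalence relation containing glue.                             *)
Definition glue_equiv : rel pre_vertex :=
  connect (fun x y => glue x y || glue y x).

Fact glue_equiv_refl : reflexive glue_equiv.
Proof. exact: connect0. Qed.
Fact glue_equiv_sym : symmetric glue_equiv.
Proof. by apply: sym_connect_sym => x y; rewrite orbC. Qed.
Fact glue_equiv_trans : transitive glue_equiv.
Proof. exact: connect_trans. Qed.

Canonical glue_equivRel :=
  EquivRel glue_equiv glue_equiv_refl glue_equiv_sym glue_equiv_trans.

Definition split_vertex : Type := {eq_quot glue_equivRel}.
HB.instance Definition _ := Choice.on split_vertex.
HB.instance Definition _ := EqQuotient.on split_vertex.
HB.instance Definition _ :=
  Countable.copy split_vertex (can_type (@reprK _ split_vertex)).
HB.instance Definition _ : isFinite split_vertex :=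
  CanIsFinite (@reprK _ split_vertex).

Definition split_quiver : quiver :=
  @Quiver split_vertex (Q1 Q)
    (fun a => \pi_split_vertex (inr (inl a)))
    (fun a => \pi_split_vertex (inr (inr a))).
End Gentle.

(* An isolated vertex splits off a direct factor k from kQ/I and from kQ',    *)
(* and k is not projective over k[c].                                         *)
Definition no_isolated_vertex (Q : quiver) : Prop :=
  forall i : Q0 Q, ~~ isolated i.

(* Main.v *)
(* Say that an arrow b continues a if ba is a path not in I.  By (Ge3) and
   (Ge4) this is a partial injection on arrows, and the nonzero paths form a
   k-basis of kQ/I.  An arrow a without continuation satisfies A a = k a, so a
   would be a torsion element of a projective k[c]-module.  Hence if A is finite
   projective, continuation is a permutation f of the arrows.  Conversely, if
   f^N = 1, let c act as the sum z of the nonzero paths of length N: z is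
   central, and it sends the nonzero path of length n >= 1 from a to the one of
   length n + N.  So A is finite projective iff Q has no isolated vertex and
   every arrow has a continuation, and (3) and (4) both express the latter.
   For B the same criterion applies to Q' with the zero ideal, because
   continuation in Q' coincides with continuation in Q. *)
Require Import Defs.
From HB Require Import structures.
From mathcomp Require Import all_boot all_algebra finmap boolp.
From mathcomp Require Import monalg.

Set Implicit Arguments.
Unset Strict Implicit.
Unset Printing Implicit Defensive.
Import GRing.Theory.
Local Open Scope ring_scope.

(** * Torsion in finitely generated projective modules *)

(** Projectivity splits the surjection from a free module given by the generators, so [M] embeds
    into a torsion-free module. *)
Lemma projective_torsion_free (R : idomainType) (M : lmodType R) :
  finitely_generated M -> projective M ->
  forall (r : R) (x : M), r *: x = 0 -> r != 0 -> x = 0.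
Proof.
move=> [n [v gen]] proj r x rx0 r0.
pose f (c : 'rV[R]_n) : M := \sum_i c 0 i *: v i.
have flin : linear f.
  move=> a c d; rewrite /f scaler_sumr -big_split; apply: eq_bigr => i _.
  by rewrite /= !mxE scalerDl scalerA.
pose fL : {linear 'rV[R]_n -> M} :=
  HB.pack f (GRing.isLinear.Build R _ M _ f flin).
have [y|h hK] := proj _ _ fL idfun.
  have [c ->] := gen y; exists (\row_i c i).
  by apply: eq_bigr => i _; rewrite mxE.
have h0 : h x = 0.
  apply/rowP => i; rewrite mxE; apply/eqP.
  have /rowP/(_ i)/eqP : r *: h x = 0 by rewrite -linearZ rx0 linear0.
  by rewrite !mxE mulf_eq0 (negPf r0).
by rewrite -[x]hK h0 linear0.
Qed.

(** * Polynomial algebra structures from a central element *)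

Section PolynomialAction.
Variables (k : fieldType) (A : pzRingType) (iota : algebra_structure k A).
Variable z : A.
Hypothesis z_central : forall x, z * x = x * z.

Let ev (p : {poly k}) : A := \sum_(i < size p) iota p`_i * z ^+ i.

Let ev_widen n (p : {poly k}) :
  (size p <= n)%N -> ev p = \sum_(i < n) iota p`_i * z ^+ i.
Proof.
move=> le_pn; rewrite /ev (big_ord_widen n (fun i => iota p`_i * z ^+ i)) //.
rewrite big_mkcond; apply: eq_bigr => i _; case: ltnP => // /(nth_default 0) ->.
by rewrite rmorph0 mul0r.
Qed.

Let evB : zmod_morphism ev.
Proof.
move=> p q; pose n := maxn (size p) (size q).
have le_pqn : (size (p - q)%R <= n)%N.
  by rewrite (leq_trans (size_polyD _ _)) // size_polyN.
rewrite (ev_widen le_pqn) (ev_widen (leq_maxl (size p) (size q))).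
rewrite (ev_widen (leq_maxr (size p) (size q))) -sumrB.
by apply: eq_bigr => i _; rewrite coefB rmorphB mulrBl.
Qed.

Let ev0 : ev 0 = 0. Proof. by have := evB 0 0; rewrite !subrr. Qed.
Let evD p q : ev (p + q) = ev p + ev q.
Proof.
by have := evB p (0 - q); rewrite (evB 0 q) ev0 !sub0r !opprK.
Qed.

Let evZ a p : ev (a *: p) = iota a * ev p.
Proof.
rewrite (ev_widen (size_scale_leq a p)) mulr_sumr.
by apply: eq_bigr => i _; rewrite coefZ rmorphM mulrA.
Qed.

Let evMX p : ev (p * 'X) = ev p * z.
Proof.
have le_pX : (size (p * 'X)%R <= (size p).+1)%N.
  by rewrite (leq_trans (size_polyMleq _ _)) // size_polyX addn2.
rewrite (ev_widen le_pX) big_ord_recl coefMX /= rmorph0 mul0r add0r mulr_suml.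
by apply: eq_bigr => i _; rewrite coefMX /= exprSr mulrA.
Qed.

Let ev1 : ev 1 = 1.
Proof. by rewrite /ev size_poly1 big_ord1 coef1 rmorph1 mulr1. Qed.
Let evC a : ev a%:P = iota a.
Proof. by rewrite -[a%:P]mulr1 mul_polyC evZ ev1 mulr1. Qed.

Let evM p q : ev (p * q) = ev p * ev q.
Proof.
elim/poly_ind: p => [|p c IH]; first by rewrite mul0r ev0 mul0r.
rewrite mulrDl -mulrA (mulrC 'X) mulrA evD evMX mul_polyC evZ IH evD evMX evC.
by rewrite mulrDl -!mulrA z_central.
Qed.

Let ev_central p x : ev p * x = x * ev p.
Proof.
elim/poly_ind: p => [|p c IH]; first by rewrite ev0 mul0r mulr0.
by rewrite evD evMX evC mulrDl mulrDr -mulrA z_central !mulrA IH str_central.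
Qed.

Lemma polynomial_algebra_structure :
  exists phi : algebra_structure {poly k} A,
    (forall a, phi a%:P = iota a) /\ phi 'X = z.
Proof.
pose e : {rmorphism {poly k} -> A} := HB.pack ev
  (GRing.isZmodMorphism.Build _ _ ev evB)
  (GRing.isMonoidMorphism.Build _ _ ev (conj ev1 evM)).
exists (@AlgebraStructure _ A e ev_central); split; first exact: evC.
by rewrite -['X]mul1r; apply: etrans (evMX 1) _; rewrite ev1 mul1r.
Qed.
End PolynomialAction.

(** * Nonzero paths modulo an ideal generated by paths of length two *)

Section Ideals.
Variables (k : fieldType) (Q : quiver) (I : ideal (path_algebra k Q)).

Lemma monomialE c (p : qpath Q) :
  (<< c *g p >> : path_algebra k Q) = pa_scalar Q c * path_elt k p.
Proof.
rewrite /pa_scalar -[RHS]/(pa_mul (c *: pa_one k Q) << p >>).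
rewrite pa_scalel pa_mul1l; apply/malgP => u; rewrite mcoeffZ.
by rewrite [LHS]mcoeffU [in RHS]mcoeffU mulr_natr.
Qed.

Lemma path_algebra_ind (P : path_algebra k Q -> Prop) :
  P 0 -> (forall x y, P x -> P y -> P (x + y)) ->
  (forall c x, P x -> P (pa_scalar Q c * x)) ->
  (forall p, P (path_elt k p)) -> forall x, P x.
Proof.
move=> P0 PD PZ Pp; apply: pa_ind => // c p.
by apply: (eq_ind_r P _ (monomialE c p)); apply: PZ.
Qed.

Definition cont : rel (Q1 Q) :=
  [rel a b | (src b == tgt a) && `[< ~ I (arrow_elt k b * arrow_elt k a) >]].

Lemma contP a b :
  reflect (src b = tgt a /\ ~ I (arrow_elt k b * arrow_elt k a)) (cont a b).
Proof. by apply: (iffP andP) => -[/eqP ? /asboolP]. Qed.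

(** A test on consecutive arrows only; [zero_path] and [zero_pathE] relate it to membership of the
    path in [I]. *)
Definition nonzero_path (p : qpath Q) := sorted cont (arrows p).

Lemma path_elt_comp (q p r : qpath Q) : psrc q = ptgt p ->
  qpath_val r = (psrc p, arrows p ++ arrows q) ->
  path_elt k q * path_elt k p = path_elt k r.
Proof.
move=> qp rE; rewrite path_eltM; have [r' -> r'E] := pcompP qp.
by congr path_elt; apply: val_inj; rewrite /= r'E.
Qed.

Lemma path_elt_cons i a s (h : chain i (a :: s)) (h' : chain (tgt a) s) :
  path_elt k (@QPath Q (i, a :: s) h) =
  path_elt k (@QPath Q (tgt a, s) h') * arrow_elt k a.
Proof. by symmetry; apply: path_elt_comp => //=; case/andP: h => /eqP <-. Qed.

(** Some consecutive pair has its product in [I], and the path is a multiple of that product. *)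
Lemma zero_path p : ~~ nonzero_path p -> I (path_elt k p).
Proof.
case: p => [[i s] h]; rewrite /nonzero_path /arrows /=.
elim: s i h => [|a [|b s] IH] i h //=.
have h' : chain (tgt a) (b :: s) by case/andP: h.
have h'' : chain (tgt b) s by case/andP: h'.
have [ab|nab] /= := boolP (cont a b); first move=> /IH Is.
  rewrite (path_elt_cons h h'). exact: Defs.idealMr (Is _ _).
move=> _; rewrite (path_elt_cons h h') (path_elt_cons h' h'') -mulrA.
apply: Defs.idealMl; move: nab; rewrite /cont /=.
case/andP: h' => /= -> _ /=. by move/asboolPn/contrapT.
Qed.

Lemma coef_mul_eq0 (x y : path_algebra k Q) (p : qpath Q) :
  (forall q q', qpath_val p = (psrc q', arrows q' ++ arrows q) ->
     x@_q = 0 \/ y@_q' = 0) ->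
  (x * y : path_algebra k Q)@_p = 0.
Proof.
move=> H; rewrite -[x * y]/(pa_mul x y) pa_mul.unlock.
rewrite raddf_sum big1 //= => q _; rewrite raddf_sum big1 //= => q' _.
have [qq'|/pcomp_none->] := eqVneq (psrc q) (ptgt q'); last by rewrite mcoeff0.
have [r -> rE] /= := pcompP qq'; rewrite mcoeffU; case: eqP => // rp.
by have [|->|->] := H q q'; rewrite -?rp ?mul0r ?mulr0.
Qed.

Hypothesis genI : generated_by_length_two_paths I.

(** This amounts to linear independence of the nonzero paths modulo [I]. *)
Lemma ideal_coef x p : I x -> nonzero_path p -> x@_p = 0.
Proof.
move=> Ix; have [S [S2 genS]] := genI.
(* [J] is a two-sided ideal because factors of a nonzero path are nonzero; it then suffices that [J]
   contains the generators. *)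
pose J (y : path_algebra k Q) := forall p, nonzero_path p -> y@_p = 0.
have J0 : J 0 by move=> q _; rewrite mcoeff0.
have JD y z : J y -> J z -> J (y + z).
  by move=> Jy Jz q nq; rewrite [LHS]mcoeffD Jy ?Jz ?addr0.
have JMl a y : J y -> J (a * y).
  move=> Jy q nq; apply: coef_mul_eq0 => q1 q2 qE; right; apply: Jy.
  by move: nq; rewrite /nonzero_path /(arrows q) qE /= => /cat_sorted2[].
have JMr a y : J y -> J (y * a).
  move=> Jy q nq; apply: coef_mul_eq0 => q1 q2 qE; left; apply: Jy.
  by move: nq; rewrite /nonzero_path /(arrows q) qE /= => /cat_sorted2[].
have /genS/(_ (@Defs.Ideal _ J J0 JD JMl JMr)) JI := Ix.
move: p; apply: JI => _ [q Sq ->] /= p np.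
rewrite [LHS]mcoeffU; case: eqP => // qp.
have Iq : I (path_elt k q) by apply/genS => K; apply; exists q.
move: np; rewrite -{}qp => np.
(* A generator has length two and lies in [I], so its two arrows fail [cont]. *)
have := S2 _ Sq; case: q Iq np {Sq} => [[i [|a [|b []]]] h] //= Iq np _.
have h' : chain (tgt a) [:: b] by case/andP: (h).
move: Iq; rewrite (path_elt_cons h h') => Iba; exfalso.
move: np; rewrite /nonzero_path /= andbT => /contP[ba]; apply.
rewrite (_ : arrow_elt k b = path_elt k (@QPath Q (tgt a, [:: b]) h')) //.
by congr path_elt; apply: val_inj; rewrite /= ba.
Qed.

Lemma zero_pathE p : I (path_elt k p) -> ~~ nonzero_path p.
Proof.
move=> Ip; apply/negP => /(ideal_coef Ip) /eqP.
by rewrite /path_elt mcoeffU eqxx oner_eq0.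
Qed.
End Ideals.

Lemma finitely_generated_fin (R : pzRingType) (M : lmodType R) (T : finType)
    (v : T -> M) :
  (forall x, exists c : T -> R, x = \sum_t c t *: v t) -> finitely_generated M.
Proof.
move=> gen; exists #|T|, (fun i => v (enum_val i)) => x.
have [c ->] := gen x; exists (fun i => c (enum_val i)).
by rewrite -(big_enum_val (fun t => c t *: v t)); apply: eq_bigl.
Qed.

(** * Algebras presented by a surjection from a path algebra with kernel [I] *)

Section Presentation.
Variables (k : fieldType) (Q : quiver) (I : ideal (path_algebra k Q)).
Hypothesis genI : generated_by_length_two_paths I.
Variables (A : pzRingType) (pi : {rmorphism path_algebra k Q -> A}).
Variable iota : algebra_structure k A.
Hypothesis pi_surj : forall x, exists y, pi y = x.
Hypothesis pi_ker : forall y, pi y = 0 <-> I y.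
Hypothesis pi_scalar : forall c, pi (pa_scalar Q c) = iota c.

(* If no arrow continues q, then A q = k q is a torsion k[c]-module. *)
Lemma continuation_exists q :
  admits_finite_projective_polyalgebra iota -> ~ I (path_elt k q) ->
  exists b, src b = ptgt q /\ ~ I (arrow_elt k b * path_elt k q).
Proof.
move=> [phi [phiC [fg pr]]] nIq; apply: contrapT => nob.
have kill b : I (arrow_elt k b * path_elt k q).
  have [sb|nsb] := eqVneq (src b) (ptgt q).
    by apply: contrapT => nIb; apply: nob; exists b.
  by rewrite /arrow_elt path_eltM pcomp_none //; apply: Defs.ideal0.
have scal y : exists l, I (y * path_elt k q - pa_scalar Q l * path_elt k q).
  elim/path_algebra_ind: y => [|x y [l Il] [m Im]|c x [l Il]|[[i s] h]].
  - by exists 0; rewrite rmorph0 subrr; apply: Defs.ideal0.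
  - exists (l + m); rewrite rmorphD !mulrDl opprD addrACA.
    exact (Defs.idealD Il Im).
  - exists (c * l); rewrite rmorphM -!mulrA -mulrBr; exact: Defs.idealMl.
  case: s h => [|a s] h.
    have -> : QPath h = trivial_path i by apply: val_inj.
    rewrite path_eltM pcomp_triv_l; case: eqP => _ /=.
      by exists 1; rewrite rmorph1 mul1r subrr; apply: Defs.ideal0.
    by exists 0; rewrite rmorph0 mul0r subrr; apply: Defs.ideal0.
  have h' : chain (tgt a) s by case/andP: (h).
  exists 0; rewrite rmorph0 mul0r subr0 (path_elt_cons _ h h') -mulrA.
  exact: Defs.idealMl.
(* The variable acts on the image of [q] as a scalar [l], so the nonzero polynomial ['X - l%:P]
   annihilates it. *)
have [t tE] := pi_surj (phi 'X); have [l /pi_ker] := scal t.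
rewrite rmorphB !rmorphM pi_scalar tE -phiC -mulrBl -rmorphB => tors.
apply: nIq; apply/pi_ker.
apply: (projective_torsion_free fg pr tors); by rewrite polyXsubC_eq0.
Qed.

Lemma presentation_ind (P : A -> Prop) :
  P 0 -> (forall x y, P x -> P y -> P (x + y)) ->
  (forall c x, P x -> P (iota c * x)) ->
  (forall p, nonzero_path I p -> P (pi (path_elt k p))) -> forall x, P x.
Proof.
move=> P0 PD PZ Pp x; have [y <-] := pi_surj x.
elim/path_algebra_ind: y => [|y z Py Pz|c y Py|p].
- by rewrite rmorph0.
- by rewrite rmorphD; apply: PD.
- by rewrite rmorphM pi_scalar; apply: PZ.
have [/Pp//|/zero_path/pi_ker->//] := boolP (nonzero_path I p).
Qed.

Lemma pa_scalarM c (x : path_algebra k Q) : pa_scalar Q c * x = c *: x.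
Proof. by rewrite -[LHS]/(pa_mul (c *: pa_one k Q) x) pa_scalel pa_mul1l. Qed.

(** The nonzero paths form a [k]-basis of [A], so their images can be prescribed; [M] is a [k]-space
    through the constant polynomials. *)
Lemma linear_extension (M : lmodType {poly k}) (H : qpath Q -> M) :
  (forall p, ~~ nonzero_path I p -> H p = 0) ->
  exists h : A -> M, [/\ zmod_morphism h,
    forall c x, h (iota c * x) = c%:P *: h x &
    forall p, h (pi (path_elt k p)) = H p].
Proof.
move=> H0.
pose hK (x : path_algebra k Q) := \sum_(p <- msupp x) (x@_p)%:P *: H p.
have hKw (d : {fset qpath Q}) x : (msupp x `<=` d)%fset ->
    hK x = \sum_(p <- d) (x@_p)%:P *: H p.
  move=> le; apply: big_fset_incl => // p _ /mcoeff_outdom ->.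
  by rewrite polyC0 scale0r.
have hKB x y : hK (x - y) = hK x - hK y.
  rewrite (hKw _ _ (msuppB_le x y)) (hKw _ _ (fsubsetUl (msupp x) (msupp y))).
  rewrite (hKw _ _ (fsubsetUr (msupp x) (msupp y))) -sumrB.
  by apply: eq_bigr => p _; rewrite -scalerBl -polyCB -mcoeffB.
have hKZ c x : hK (pa_scalar Q c * x) = c%:P *: hK x.
  rewrite pa_scalarM (hKw _ _ (msuppZ_le c x)) scaler_sumr.
  by apply: eq_bigr => p _; rewrite scalerA -polyCM -mcoeffZ.
have hKp p : hK (path_elt k p) = H p.
  by rewrite (hKw _ _ msuppU_le) big_seq_fset1 mcoeffUU scale1r.
(* Coefficients at nonzero paths vanish on [I], so [hK] descends to [A]. *)
have hKI x : I x -> hK x = 0.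
  move=> Ix; apply: big1 => p _.
  have [np|/H0->] := boolP (nonzero_path I p); last by rewrite scaler0.
  by rewrite (ideal_coef genI Ix np) scale0r.
have [l lK] := choice pi_surj.
have hlK x : hK (l (pi x)) = hK x.
  apply/eqP; rewrite -subr_eq0 -hKB hKI //; apply/pi_ker.
  by rewrite rmorphB lK subrr.
exists (hK \o l); split => [x y|c x|p] /=; last by rewrite hlK hKp.
  by rewrite -hKB -[RHS]hlK rmorphB !lK.
by rewrite -hKZ -[RHS]hlK rmorphM pi_scalar lK.
Qed.
End Presentation.

(** * Projectivity of a module with a periodic basis *)

Section PeriodicModule.
Variables (k : fieldType) (V E : finType) (src : E -> V) (m : nat).
Local Notation N := m.+1.
Variable start : V -> E.
Hypothesis src_start : forall i, src (start i) = i.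
(** Here [e i] models a trivial path and [w a n] the nonzero path of [n.+1] arrows from [a]. [M_ind]
    and [M_ext] together say that these elements form a [k]-basis. *)
Variables (M : lmodType {poly k}) (e : V -> M) (w : E -> nat -> M).
Hypothesis Xe : forall i, 'X *: e i = \sum_(a | src a == i) w a m.
Hypothesis Xw : forall a n, 'X *: w a n = w a (n + N).
Hypothesis M_ind : forall P : M -> Prop,
  P 0 -> (forall x y, P x -> P y -> P (x + y)) ->
  (forall c x, P x -> P (c%:P *: x)) ->
  (forall i, P (e i)) -> (forall a n, P (w a n)) -> forall x, P x.
Hypothesis M_ext :
  forall (L : lmodType {poly k}) (he : V -> L) (hw : E -> nat -> L),
  exists h : M -> L, [/\ zmod_morphism h,
    forall c x, h (c%:P *: x) = c%:P *: h x,
    forall i, h (e i) = he i & forall a n, h (w a n) = hw a n].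

Lemma scaleXn_periodic a n q : 'X^q *: w a n = w a (n + q * N).
Proof.
elim: q => [|q IH]; first by rewrite expr0 scale1r mul0n addn0.
by rewrite exprS -scalerA IH Xw mulSn -addnA [(_ * _ + _)%N]addnC.
Qed.

Lemma periodic_finitely_generated : finitely_generated M.
Proof.
pose v (t : V + E * 'I_N) : M :=
  match t with inl i => e i | inr (a, r) => w a r end.
apply: (@finitely_generated_fin _ M _ v); apply: M_ind.
- by exists (fun=> 0); rewrite big1 // => t _; rewrite scale0r.
- move=> x y [c ->] [d ->]; exists (fun t => c t + d t).
  by rewrite -big_split; apply: eq_bigr => t _; rewrite scalerDl.
- move=> a x [c ->]; exists (fun t => a%:P * c t).
  by rewrite scaler_sumr; apply: eq_bigr => t _; rewrite scalerA.
- move=> i; exists (fun t => (t == inl i)%:R); rewrite (bigD1 (inl i)) //= big1.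
    by rewrite eqxx scale1r addr0.
  by move=> t /negPf->; rewrite scale0r.
move=> a n; pose t0 : V + E * 'I_N := inr (a, inord (n %% N)%N).
exists (fun t => if t == t0 then 'X^(n %/ N)%N else 0).
rewrite (bigD1 t0) //= big1.
  rewrite eqxx addr0 inordK; last by rewrite ltn_pmod.
  by rewrite scaleXn_periodic addnC -divn_eq.
by move=> t /negPf->; rewrite scale0r.
Qed.

(** The module is in fact free: the relations [Xe] eliminate the generators [w (start i) m] from the
    [e i] and the [w a r] with [r < N]. *)
Lemma periodic_projective : projective M.
Proof.
move=> P0 P1 p g psurj; have [L LK] := choice psurj.
(* Since [X e_i] is the sum of the [w a m] with [src a = i], the lift of
   [w (start i) m] is forced by the lifts of [e i] and of the other ones. *)
pose H a (r : nat) : P0 :=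
  if (r == m) && (a == start (src a)) then
    'X *: L (g (e (src a))) -
      \sum_(b | (src b == src a) && (b != a)) L (g (w b m))
  else L (g (w a r)).
have pH a r : p (H a r) = g (w a r).
  rewrite /H; case: ifP => [/andP[/eqP-> _]|_]; last by rewrite LK.
  rewrite linearB linearZ linear_sum /= LK -linearZ /= Xe (bigD1 a) //=.
  rewrite linearD linear_sum /=; under [X in _ - X]eq_bigr do rewrite LK.
  by rewrite addrK.
have sumH i : \sum_(a | src a == i) H a m = 'X *: L (g (e i)).
  rewrite (bigD1 (start i)) ?src_start //= {1}/H src_start !eqxx /=.
  rewrite -[RHS]addr0 -addrA; congr (_ + _); apply/eqP.
  rewrite addrC subr_eq0; apply/eqP; apply: eq_bigr => a /andP[/eqP sa ai].
  by rewrite /H sa (negPf ai) andbF.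
have [h [hB hZ he hw]] := M_ext (fun i => L (g (e i)))
  (fun a n => 'X^(n %/ N)%N *: H a (n %% N)%N).
pose hA : {additive M -> P0} := HB.pack h (GRing.isZmodMorphism.Build _ _ h hB).
have h0 : h 0 = 0 := raddf0 hA.
have hD : {morph h : x y / x + y} := raddfD hA.
(* [M_ext] gives only a [k]-linear map; commuting with ['X] makes it linear over polynomials. At
   [e i] this is [sumH]. *)
have hX x : h ('X *: x) = 'X *: h x.
  elim/M_ind: x => [|x y Hx Hy|c x Hx|i|a n].
  - by rewrite scaler0 h0 scaler0.
  - by rewrite scalerDr !hD Hx Hy scalerDr.
  - by rewrite scalerA mulrC -scalerA !hZ Hx !scalerA mulrC.
  - rewrite Xe -[h]/(hA : M -> P0) raddf_sum /= he -sumH; apply: eq_bigr => a _.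
    by rewrite hw divn_small // modn_small // expr0 scale1r.
  by rewrite Xw !hw divnDr // divnn /= addn1 modnDr exprS scalerA.
have hlin : linear h.
  move=> r x y; rewrite hD; congr (_ + _).
  elim/poly_ind: r x => [|r c IH] x; first by rewrite !scale0r h0.
  by rewrite !scalerDl -!scalerA hD /= IH hX hZ.
pose hL : {linear M -> P0} := HB.pack h (GRing.isLinear.Build _ _ _ _ h hlin).
exists hL => x; rewrite -[hL x]/(h x).
elim/M_ind: x => [|x y Hx Hy|c x Hx|i|a n].
- by rewrite h0 !linear0.
- by rewrite hD !linearD Hx Hy.
- by rewrite hZ !linearZ /= Hx.
- by rewrite he LK.
by rewrite hw linearZ /= pH -linearZ /= scaleXn_periodic addnC -divn_eq.
Qed.
End PeriodicModule.

(** * The central element when continuation is a periodic map *)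

Section CyclicContinuation.
Variables (k : fieldType) (Q : quiver) (I : ideal (path_algebra k Q)).
Hypothesis genI : generated_by_length_two_paths I.
Variables (A : pzRingType) (pi : {rmorphism path_algebra k Q -> A}).
Variable iota : algebra_structure k A.
Hypothesis pi_surj : forall x, exists y, pi y = x.
Hypothesis pi_ker : forall y, pi y = 0 <-> I y.
Hypothesis pi_scalar : forall c, pi (pa_scalar Q c) = iota c.

Variable f : Q1 Q -> Q1 Q.
Hypothesis contE : forall a b, cont I a b = (f a == b).
Variable m : nat.
Local Notation N := m.+1.
Hypothesis iterN : forall a, iter N f a = a.
Variable start : Q0 Q -> Q1 Q.
Hypothesis src_start : forall i, src (start i) = i.

Lemma chain_traject a n : chain (src a) (traject f a n).
Proof.
elim: n a => //= n IH a; rewrite eqxx /=.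
have : cont I a (f a) by rewrite contE.
by case/contP => <- _; apply: IH.
Qed.

(** For [n = 0] this is the trivial path at the source of [a], so nontrivial paths are indexed by
    [n.+1]. *)
Definition iter_path a n : qpath Q :=
  @QPath Q (src a, traject f a n) (chain_traject a n).

Lemma ptgt_iter_path a n : ptgt (iter_path a n) = src (iter n f a).
Proof.
case: n => //= n; have : cont I (iter n f a) (iter n.+1 f a) by rewrite contE.
case/contP => -> _; rewrite /ptgt /chain_tgt /= (last_map (@tgt Q)).
by rewrite last_traject.
Qed.

Lemma sorted_contE : sorted (cont I) =1 sorted (frel f).
Proof. by apply: eq_sorted => a b; rewrite contE. Qed.

Lemma nonzero_iter_path a n : nonzero_path I (iter_path a n).
Proof.
by case: n => // n; rewrite /nonzero_path sorted_contE /=; apply: fpath_traject.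
Qed.

Lemma nonzero_pathP p : nonzero_path I p ->
  (exists i, p = trivial_path i) \/ exists a n, p = iter_path a n.+1.
Proof.
case: p => [[i [|a s]] h]; rewrite /nonzero_path sorted_contE.
  by left; exists i; apply: val_inj.
move=> /fpathP[n sE]; right; exists a, n; apply: val_inj.
by case/andP: (h) => /= /eqP <- _; rewrite sE.
Qed.

Let e i := pi (path_elt k (trivial_path i)).
Let w a n := pi (path_elt k (iter_path a n)).
Let z := \sum_a w a N.

Let ww a n l : w (iter n f a) l * w a n = w a (n + l).
Proof.
rewrite -rmorphM (path_elt_comp k (r := iter_path a (n + l))) //.
  by rewrite ptgt_iter_path.
by rewrite /= trajectD.
Qed.

(** If the paths compose at all, [b] does not continue the last arrow of the first one. *)
Let ww0 a b n l : b != iter n.+1 f a -> w b l.+1 * w a n.+1 = 0.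
Proof.
move=> ba; rewrite -rmorphM path_eltM.
have [bt|/pcomp_none->] :=
  eqVneq (psrc (iter_path b l.+1)) (ptgt (iter_path a n.+1)).
  have [r -> rE] /= := pcompP bt; apply/pi_ker/zero_path.
  rewrite /nonzero_path sorted_contE /arrows rE /= cat_path last_traject /=.
  by rewrite -iterS eq_sym (negPf ba) andbF.
by rewrite rmorph0.
Qed.

Let ew i a n : e i * w a n = if i == src (iter n f a) then w a n else 0.
Proof.
rewrite -rmorphM path_eltM pcomp_triv_l ptgt_iter_path.
by case: eqP => //= _; rewrite rmorph0.
Qed.

Let we i a n : w a n * e i = if src a == i then w a n else 0.
Proof.
rewrite -rmorphM path_eltM pcomp_triv_r [psrc _]/=.
by case: eqP => //= _; rewrite rmorph0.
Qed.

Let ze i : z * e i = \sum_(a | src a == i) w a N.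
Proof.
by rewrite mulr_suml [RHS]big_mkcond; apply: eq_bigr => a _; rewrite we.
Qed.

Let ez i : e i * z = \sum_(a | src a == i) w a N.
Proof.
rewrite mulr_sumr [RHS]big_mkcond; apply: eq_bigr => a _.
(* By periodicity [w a N] ends where it starts, so both sides of [z] select the same arrows. *)
by rewrite ew iterN eq_sym.
Qed.

Let zw a n : z * w a n.+1 = w a (n.+1 + N).
Proof.
rewrite mulr_suml (bigD1 (iter n.+1 f a)) //= big1 ?addr0 => [|b ba].
  exact: (ww a n.+1 N).
by rewrite ww0.
Qed.

Let wz a n : w a n.+1 * z = w a (n.+1 + N).
Proof.
rewrite mulr_sumr (bigD1 a) //= big1 ?addr0 => [|b ba].
  (* After the [N] arrows of [w a N] the next arrow is again [a]. *)
  by rewrite -[X in w X n.+1](iterN a) ww addnC.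
by rewrite ww0 // iterN eq_sym.
Qed.

Let A_ind (P : A -> Prop) :
  P 0 -> (forall x y, P x -> P y -> P (x + y)) ->
  (forall c x, P x -> P (iota c * x)) ->
  (forall i, P (e i)) -> (forall a n, P (w a n.+1)) -> forall x, P x.
Proof.
move=> P0 PD PZ Pe Pw; apply: (presentation_ind pi_surj pi_ker pi_scalar) => //.
by move=> p /nonzero_pathP[[i ->]|[a [n ->]]]; [apply: Pe|apply: Pw].
Qed.

Let z_central x : z * x = x * z.
Proof.
elim/A_ind: x => [|x y Hx Hy|c x Hx|i|a n].
- by rewrite mul0r mulr0.
- by rewrite mulrDr Hx Hy mulrDl.
- by rewrite mulrA -str_central -mulrA Hx mulrA.
- by rewrite ze ez.
- by rewrite zw wz.
Qed.

Lemma finite_projective_of_cyclic : admits_finite_projective_polyalgebra iota.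
Proof.
have [phi [phiC phiX]] := polynomial_algebra_structure iota z_central.
(* The index is shifted by one: [wM a m] is the path of length [N] occurring in [z]. *)
pose M := alg_module phi; pose eM i : M := e i; pose wM a n : M := w a n.+1.
have Xe i : 'X *: eM i = \sum_(a | src a == i) wM a m.
  by rewrite -[LHS]/(phi 'X * e i) phiX ze.
have Xw a n : 'X *: wM a n = wM a (n + N)%N.
  by rewrite -[LHS]/(phi 'X * w a n.+1) phiX zw.
have M_ind (P : M -> Prop) : P 0 -> (forall x y, P x -> P y -> P (x + y)) ->
    (forall c x, P x -> P (c%:P *: x)) ->
    (forall i, P (eM i)) -> (forall a n, P (wM a n)) -> forall x, P x.
  move=> P0 PD PZ Pe Pw; apply: A_ind => // c x Px.
  by rewrite -phiC; apply: PZ.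
exists phi; split=> //; split.
  exact: (periodic_finitely_generated Xw M_ind).
apply: (periodic_projective src_start Xe Xw M_ind) => L he hw.
pose H q := if ~~ nonzero_path I q then 0 else
  if arrows q is a :: s then hw a (size s) else he (psrc q).
have [|h [hB hZ hH]] := linear_extension genI pi_surj pi_ker pi_scalar (H := H).
  by move=> q nq; rewrite /H nq.
exists h; split=> // [c x|i|a n].
- by rewrite -hZ -phiC.
- by rewrite hH.
by rewrite hH /H nonzero_iter_path /= size_traject.
Qed.
End CyclicContinuation.

(** * Partial permutations of a finite set *)

Section PartialPermutation.
Variables (T : finType) (e : rel T).
Hypothesis e_fun : forall x y y', e x y -> e x y' -> y = y'.
Hypothesis e_inj : forall x x' y, e x y -> e x' y -> x = x'.

Lemma total_partial_perm : (forall x, exists y, e x y) ->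
  exists2 f : T -> T, injective f & forall x y, e x y = (f x == y).
Proof.
move=> /choice[f ef]; exists f => [x x' ff|x y].
  by apply: e_inj (ef x) _; rewrite ff.
by apply/idP/eqP => [/(e_fun (ef x))|<-].
Qed.

(** A total partial injection of a finite set is a permutation, and its orbits are the cycles;
    conversely a cycle supplies a successor, [x] itself when it has length one. *)
Lemma total_iff_cyclic :
  (forall x, exists y, e x y) <-> (forall x, exists s, cycle e (x :: s)).
Proof.
split=> [/total_partial_perm[f f_inj ef] x|cyc x]; last first.
  by have [[|y s]] := cyc x => [/andP[xx _]|/andP[xy _]]; [exists x|exists y].
exists (behead (orbit f x)); move: (cycle_orbit f_inj x).
rewrite /orbit -orderSpred /= => fc.
by rewrite (eq_path (e' := frel f)) // => u v; rewrite /= ef.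
Qed.
End PartialPermutation.

(** Each orbit length is at most [#|T|], hence divides the factorial: one exponent serves all
    points. *)
Lemma iter_fact_card (T : finType) (f : T -> T) x :
  injective f -> iter ((#|T|)`!) f x = x.
Proof.
move=> f_inj; have /dvdnP[q ->] : (order f x %| (#|T|)`!)%N.
  by rewrite dvdn_fact // order_gt0 max_card.
by elim: q => //= q IH; rewrite mulSn iterD IH iter_order.
Qed.

(** * Cyclic paths as cycles of arrows *)

Definition composable (Q : quiver) : rel (Q1 Q) := [rel a b | src b == tgt a].

Lemma chain_path (Q : quiver) (i : Q0 Q) a s :
  chain i (a :: s) = (src a == i) && path (@composable Q) a s.
Proof. by elim: s i a => //= b s IH i a; rewrite -IH. Qed.

Lemma cyclic_path_iff (Q : quiver) (a : Q1 Q) :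
  (exists2 p, cyclic_path p & a \in arrows p) <->
  exists s, cycle (@composable Q) (a :: s).
Proof.
split=> [[[[i [|c s]] h] [//= _ pcyc] ap]|[s]].
  have cyc : cycle (@composable Q) (c :: s).
    have := h; rewrite chain_path /= rcons_path => /andP[/eqP ci ->] /=.
    by rewrite /composable /= ci [i]pcyc /ptgt /chain_tgt /= (last_map (@tgt Q)).
  (* A cycle of arrows may be rotated to start at [a]. *)
  have [n s' rE] := rot_to ap; exists s'.
  by move: cyc; rewrite -(rot_cycle n) [rot _ _]rE.
rewrite /= rcons_path => /andP[cs /eqP cl].
have h : chain (src a) (a :: s) by rewrite chain_path eqxx.
exists (@QPath Q (src a, a :: s) h); last exact: mem_head.
by split=> //; rewrite /ptgt /chain_tgt /= (last_map (@tgt Q)).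
Qed.

(** * The criterion by continuations, and admissible cycles *)

Section Characterization.
Variables (k : fieldType) (Q : quiver) (I : ideal (path_algebra k Q)).
Hypothesis genI : generated_by_length_two_paths I.
Hypothesis cont_fun : forall a b b', cont I a b -> cont I a b' -> b = b'.
Hypothesis cont_inj : forall a a' b, cont I a b -> cont I a' b -> a = a'.

Lemma finite_projective_iff (A : pzRingType)
    (pi : {rmorphism path_algebra k Q -> A}) (iota : algebra_structure k A) :
  (forall x, exists y, pi y = x) -> (forall y, pi y = 0 <-> I y) ->
  (forall c, pi (pa_scalar Q c) = iota c) ->
  admits_finite_projective_polyalgebra iota <->
  no_isolated_vertex Q /\ forall a, exists b, cont I a b.
Proof.
move=> pi_surj pi_ker pi_scalar; split=> [fp|[noiso tot]].
  have next q := continuation_exists pi_surj pi_ker pi_scalar (q := q) fp.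
  split=> [i|a].
    (* What continues a trivial path is an arrow starting at its vertex. *)
    have [/(zero_pathE genI)//|b [bi _]] := next (trivial_path i).
    by apply/negP => /forallP/(_ b); rewrite bi eqxx.
  have [/(zero_pathE genI)//|b [ba nI]] := next (arrow_path a).
  by exists b; apply/contP.
have [f f_inj contE] := total_partial_perm cont_fun cont_inj tot.
(* If an arrow [a] ends at [i], then its continuation [f a] starts there. *)
have /choice[start src_start] i : exists a : Q1 Q, src a = i.
  have /forallPn[a] := noiso i.
  rewrite negb_and !negbK => /orP[/eqP <-|/eqP <-]; first by exists a.
  by exists (f a); have /contP[] : cont I a (f a) by rewrite contE.
have iterN a : iter ((#|Q1 Q|)`!.-1.+1) f a = a.
  by rewrite prednK ?fact_gt0 // iter_fact_card.
by apply: (finite_projective_of_cyclic genI pi_surj pi_ker pi_scalar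
  contE iterN src_start).
Qed.

(** Maximality comes for free on a repetition-free cycle of continuations: the first arrow is the
    only continuation of the last. *)
Lemma admissible_cycle_iff a :
  (exists2 p, admissible_cycle I p & a \in arrows p) <->
  exists s, cycle (cont I) (a :: s).
Proof.
split=> [[p [c [[s pE [_ nIp _]] [_ pcyc] nIc]] ap]|[s]].
  have cyc : cycle (cont I) (c :: s).
    rewrite /= rcons_path; apply/andP; split.
      have : nonzero_path I p by apply: contra_notT nIp; apply: zero_path.
      by rewrite /nonzero_path pE.
    apply/contP; split; last by rewrite pE in nIc.
    have /= : chain (psrc p) (arrows p) := valP p.
    rewrite pE chain_path => /andP[/eqP -> _].
    by rewrite pcyc /ptgt /chain_tgt pE /= (last_map (@tgt Q)).
  rewrite pE in ap; have [n s' rE] := rot_to ap.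
  by exists s'; move: cyc; rewrite -(rot_cycle n) rE.
(* Removing repetitions keeps the first and last arrows, hence the closing step back to [a]. *)
rewrite /= rcons_path => /andP[/shortenP[s' cs us _] cl].
have h : chain (src a) (a :: s').
  by rewrite chain_path eqxx; apply: sub_path cs => u v /contP[] /eqP.
have [ca nI] := contP _ _ _ cl.
exists (@QPath Q (src a, a :: s') h); last exact: mem_head.
exists a; split=> //.
  exists s' => //; split=> // [/(zero_pathE genI)/negP//|b bl].
  have [Ib|nIb] := pselect (I (arrow_elt k b * arrow_elt k (last a s'))).
    by right.
  by left; apply: cont_fun cl; apply/contP.
by split=> //; rewrite /ptgt /chain_tgt /= (last_map (@tgt Q)).
Qed.
End Characterization.

(** * Vertices and composition in the split quiver *)

Section SplitQuiver.
Variables (k : fieldType) (Q : quiver) (I : ideal (path_algebra k Q)).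
Hypothesis cont_fun : forall a b b', cont I a b -> cont I a b' -> b = b'.
Hypothesis cont_inj : forall a a' b, cont I a b -> cont I a' b -> a = a'.
Local Notation Q' := (split_quiver I).

Lemma glueP (x y : pre_vertex Q) :
  reflect (exists a b, [/\ cont I a b, x = inr (inl b) & y = inr (inr a)])
          (glue I x y).
Proof.
case: x y => [i|[b|b]] [j|[a|a]] /=; try by right=> -[? [? []]].
apply: (iffP (asboolP _)) => [ab|[a' [b' [/contP ab [->] [->]]]]//].
by exists a, b; split=> //; apply/contP.
Qed.

(** Each [s_b] is glued to at most one [t_a] and conversely, so two successive gluing steps cancel
    and classes have at most two elements. *)
Lemma glue_equivE x y :
  glue_equiv I x y = [|| x == y, glue I x y | glue I y x].
Proof.
apply/idP/or3P => [/connectP[p]|[/eqP->|xy|yx]]; last 3 first.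
- exact: connect0.
- by apply: connect1; rewrite xy.
- by apply: connect1; rewrite yx orbT.
elim: p x => [|y' p IH] x /=; first by move=> _ ->; constructor 1.
case/andP=> xy' /IH + yE => /(_ yE){IH}.
case/orP: xy' => /glueP[a [b [ab -> ->]]]
  [/eqP <-|/glueP[a' [b' []]]|/glueP[a' [b' []]]] //.
- by constructor 2; apply/glueP; exists a, b.
- move=> ab' -> [aa']; rewrite -aa' in ab'.
  by rewrite (cont_fun ab' ab); constructor 1.
- by constructor 3; apply/glueP; exists a, b.
- move=> ab' [bb'] ->; rewrite -bb' in ab'.
  by rewrite (cont_inj ab' ab); constructor 1.
Qed.

(** The points [s_b] and [t_a] are distinct, so they share a class only if they are glued
    directly. *)
Lemma composable_split (a b : Q1 Q') : composable a b = cont I a b.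
Proof.
rewrite /composable /= eqmodE [LHS]glue_equivE /= orbF.
by apply/asboolP/contP.
Qed.

(** Points of [Q_0^*] are never glued, and every other class is the source or target of an arrow. *)
Lemma isolated_split (i : Q0 Q') :
  isolated i <-> exists x, i = \pi_(split_vertex I)%qT (inl x).
Proof.
split=> [|[x ->]].
  elim/quotW: i => -[x|[a|a]] /forallP iso; first by exists x.
    by have /andP[/eqP] := iso a.
  by have /andP[_ /eqP] := iso a.
apply/forallP => a; rewrite /= !eqmodE.
by apply/andP; split; rewrite [X in ~~ X]glue_equivE.
Qed.

Lemma no_isolated_split : no_isolated_vertex Q' <-> no_isolated_vertex Q.
Proof.
split=> noiso i; apply/negP => iso; last first.
  have [[j ij] _] := iffLR (isolated_split i) iso.
  exact: (negP (noiso j) ij).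
pose x : {i : Q0 Q | isolated i} := Sub i iso.
apply: (negP (noiso (\pi_(split_vertex I)%qT (inl x)))).
by apply/isolated_split; exists x.
Qed.
End SplitQuiver.

(** * A path algebra as its quotient by the zero ideal *)

Section ZeroIdeal.
Variables (k : fieldType) (Q : quiver).
Local Notation kQ := (path_algebra k Q).

Definition zero_ideal : ideal kQ.
Proof.
apply: (@Defs.Ideal kQ (fun x => x = 0)) => //.
- by move=> x y -> ->; rewrite addr0.
- by move=> a x ->; rewrite mulr0.
- by move=> a x ->; rewrite mul0r.
Defined.

Lemma zero_ideal_generated : generated_by_length_two_paths zero_ideal.
Proof.
exists (fun=> False); split=> // x; split=> [-> J _|H].
  exact: Defs.ideal0.
by apply: H => y [].
Qed.

Lemma cont_zero_ideal : cont zero_ideal =2 @composable Q.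
Proof.
move=> a b; apply/idP/idP => [/contP[/eqP]//|/eqP ba].
apply/contP; split=> //=; rewrite path_eltM.
have [r -> _] /= := @pcompP _ (arrow_path b) (arrow_path a) ba.
by move/(congr1 (mcoeff r)); rewrite mcoeffUU mcoeff0; apply/eqP/oner_neq0.
Qed.
End ZeroIdeal.

(** * Comparison of the four conditions *)

Theorem proposition8p4 (k : fieldType) (Q : quiver)
    (I : ideal (path_algebra k Q)) (gentleI : gentle I) :
  let Q' := split_quiver I in
  let A_finite_projective : Prop :=
    admits_finite_projective_polyalgebra
      (quotient_algebra I (path_algebra_str k Q)) in
  let B_finite_projective : Prop :=
    admits_finite_projective_polyalgebra (path_algebra_str k Q') in
  let arrows_on_cyclic_paths : Prop :=
    forall a : Q1 Q', exists2 p : qpath Q', cyclic_path p & a \in arrows p in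
  let arrows_on_admissible_cycles : Prop :=
    forall a : Q1 Q, exists2 p : qpath Q, admissible_cycle I p & a \in arrows p in
  [/\ no_isolated_vertex Q ->
        [<-> A_finite_projective; B_finite_projective;
             arrows_on_cyclic_paths; arrows_on_admissible_cycles],
      A_finite_projective <-> B_finite_projective,
      arrows_on_cyclic_paths <-> arrows_on_admissible_cycles
    & A_finite_projective -> arrows_on_cyclic_paths].
Proof.
move=> Q' FA FB cyc adm; have [genI _ _ ge3 ge4] := gentleI.
have cont_fun a b b' : cont I a b -> cont I a b' -> b = b'.
  move=> /contP[sb nb] /contP[sb' nb'].
  by have [_ H] := ge3 a b b' sb sb'; exact (H nb nb').
have cont_inj a a' b : cont I a b -> cont I a' b -> a = a'.
  move=> /contP[/esym ta na] /contP[/esym ta' na'].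
  by have [_ H] := ge4 b a a' ta ta'; exact (H na na').
have compE := composable_split cont_fun cont_inj.
have contZ a b : cont (zero_ideal k Q') a b = cont I a b.
  by rewrite cont_zero_ideal compE.
(* The pivot: (3) and (4) are each equivalent to [tot], (1) and (2) to [tot] together with absence
   of isolated vertices. *)
pose tot := forall a, exists b, cont I a b.
have FAE : FA <-> no_isolated_vertex Q /\ tot.
  apply: (finite_projective_iff genI cont_fun cont_inj
    (pi := quotient_map I)) => //.
    by elim/quotW => x; exists x.
  move=> y; rewrite -[X in I X]subr0 -(rmorph0 (quotient_map I)).
  by split=> [/eqP/quotient_eqP|/quotient_eqP/eqP].
have FBE : FB <-> no_isolated_vertex Q /\ tot.
  rewrite -(no_isolated_split cont_fun cont_inj).
  have -> : tot <-> forall a, exists b, cont (zero_ideal k Q') a b.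
    by split=> H a; have [b] := H a; exists b; rewrite ?contZ // -contZ.
  apply: (finite_projective_iff (zero_ideal_generated k Q') _ _
    (pi := idfun)) => //.
  - by move=> a b b'; rewrite !contZ; apply: cont_fun.
  - by move=> a a' b; rewrite !contZ; apply: cont_inj.
  - by move=> x; exists x.
have cycE : cyc <-> tot.
  rewrite /tot (total_iff_cyclic cont_fun cont_inj).
  have cycE a : (exists s, cycle (@composable Q') (a :: s)) <->
      exists s, cycle (cont I) (a :: s).
    split=> -[s cs]; exists s.
      by rewrite -[X in is_true X](eq_cycle compE (a :: s)).
    by rewrite [X in is_true X](eq_cycle compE (a :: s)).
  by split=> H a; [apply/cycE/cyclic_path_iff|apply/cyclic_path_iff/cycE].
have admE : adm <-> tot.
  rewrite /tot (total_iff_cyclic cont_fun cont_inj).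
  by split=> H a; apply/(admissible_cycle_iff genI cont_fun).
split.
- by move=> noiso; tfae; rewrite ?FAE ?FBE ?cycE ?admE; tauto.
- by rewrite FAE FBE.
- by rewrite cycE admE.
by rewrite FAE cycE => -[].
Qed.
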